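(* Let $X,Y$ be Banach spaces, $U\subset X$ open, $f\colon U\to Y$ continuously differentiable, and let $x_0\in U$ be such that $D:=df(x_0)\colon X\to Y$ is surjective and has a bounded linear right inverse $Q\colon Y\to X$. Let $\delta,c>0$ be constants such that $\|Q\|\le c$, the open ball $B_\delta(x_0;X)$ is contained in $U$, and $\|df(x)-D\|\le\frac{1}{2c}$ whenever $\|x-x_0\|<\delta$. Then the Newton-Picard map $\mathcal{N}\colon U_0\to X$ (defined in the context) is continuously differentiable.
   Context: The domain is the open set $U_0=\{x_1\in B_{\delta/8}(x_0;X)\mid \|f(x_1)\|_Y<\frac{\delta}{4c}\}$. It is a known result of McDuff and Salamon that, under the stated hypotheses, for each $x_1\in U_0$ there is a unique $x\in X$ with $$f(x)=0,\qquad x-x_1\in\operatorname{im}Q,\qquad \|x-x_0\|<\delta,$$ and moreover $\|x-x_1\|\le 2c\|f(x_1)\|$. The Newton-Picard map $\mathcal{N}=\mathcal{N}^f_{x_0,Q}\colon U_0\to X$ is defined by $x_1\mapsto x$. *)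

(* Defs.v *)
From HB Require Import structures.
From mathcomp Require Import all_boot all_order all_algebra.
From mathcomp Require Import all_classical all_reals all_analysis.

Set Implicit Arguments.
Unset Strict Implicit.
Unset Printing Implicit Defensive.

Import Order.TTheory GRing.Theory Num.Theory.
Import numFieldNormedType.Exports.

Local Open Scope classical_set_scope.
Local Open Scope ring_scope.

(* The supremum is taken in \bar R, so that an unbounded linear map has
   norm +oo. *)
Definition opnorm (R : realType) (X Y : normedModType R) (L : X -> Y) : \bar R :=
  ereal_sup [set `|L v|%:E | v in [set v : X | `|v| <= 1]].

(* Maps on an open set A are represented by total functions; as A is open, the
   differential at a point of A depends only on the restriction to A. *)
Definition continuously_differentiable_on (R : realType) (X Y : normedModType R)
    (A : set X) (g : X -> Y) : Prop :=
  (forall x, A x -> differentiable g x) /\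
  (forall x, A x ->
     opnorm ('d g y \- 'd g x) @[y --> within A (nbhs x)] --> 0%E).

Definition newton_picard_dom (R : realType) (X Y : normedModType R)
    (f : X -> Y) (x0 : X) (delta c : R) : set X :=
  [set x1 | ball x0 (delta / 8) x1 /\ `|f x1| < delta / (4 * c)].

(* Under the hypotheses of the theorem there is, for x1 in the domain, exactly
   one x as below; the default value 0 is only ever taken off the domain. *)
Definition newton_picard (R : realType) (X Y : normedModType R)
    (f : X -> Y) (x0 : X) (Q : Y -> X) (delta : R) (x1 : X) : X :=
  xget 0 [set x | [/\ f x = 0, range Q (x - x1) & `|x - x0| < delta]].

(* Main.v *)
Require Import Defs.
From HB Require Import structures.
From mathcomp Require Import all_boot all_order all_algebra.
From mathcomp Require Import ring lra.
From mathcomp Require Import all_classical all_reals all_analysis.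
Set Implicit Arguments.
Unset Strict Implicit.
Unset Printing Implicit Defensive.

Import Order.TTheory GRing.Theory Num.Theory.
Import numFieldNormedType.Exports.
Local Open Scope classical_set_scope.
Local Open Scope ring_scope.

(** Write [D := 'd f x0] and consider the corrected map
    [Phi x := x + Q (f x - D x)].  Since [D] is a left inverse of [Q], applying
    [D] to the equation [Phi x = x1 - Q (D x1)] gives [f x = 0], and then
    [x - x1 = Q (D (x - x1))]; so the two conditions [f x = 0] and
    [x - x1 \in im Q] together amount to this single equation in [X]
    ([root_defectP]).  On the ball of radius [delta] the mean value inequality
    [mean_value_le] makes [Q \o (f - D)] Lipschitz with constant [1/2], because
    [c * (1 / (2 * c)) = 1/2].  Hence [Phi] is injective there with an inverse
    that is Lipschitz with constant [2], the contraction principle gives the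
    solution [N x1] for every [x1] of the domain ([solution_exists]), and [N] is
    Lipschitz.

    In other words [N] is the composition of the bounded linear map
    [P := id - Q \o D] with a local inverse of [Phi], and its differential must
    solve the linearised equation
    [u + Q ('d f (N x1) u - D u) = P v], where [u = 'd N x1 v].
    The operator on the left is again the identity plus a linear map of norm at
    most [1/2], hence invertible ([half_perturbation_inverse]); that its solution
    is the differential of [N] follows from the Lipschitz estimate for [N] and
    the first-order expansion of [f] at [N x1] ([newton_picard_diff]).
    Solutions of two such equations with the same right-hand side differ by at
    most a constant times the distance of the coefficients
    ([implicit_diff_close]), so ['d N] inherits its continuity from ['d f] and
    from [N]. *)

(** * Operator norm and differentials through explicit inequalities *)

Section Norms.
Context {R : realType}.

Lemma opnorm_leP (X Y : normedModType R) (L : {linear X -> Y}) (k : R) :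
  0 <= k ->
  (opnorm L <= k%:E)%E <-> (forall v, `|L v| <= k * `|v|).
Proof.
move=> k0; split=> [Lk v|Lk]; last first.
  apply: ub_ereal_sup => _ [v /= v1 <-]; rewrite lee_fin (le_trans (Lk v))//.
  by rewrite ler_piMr.
have [->|v0] := eqVneq v 0; first by rewrite linear0 !normr0 mulr0.
have nv0 : 0 < `|v| by rewrite normr_gt0.
have : `|L (`|v|^-1 *: v)| <= k.
  rewrite -lee_fin (le_trans _ Lk)//; apply: ereal_sup_ubound.
  by exists (`|v|^-1 *: v) => //=; rewrite normrZ normfV normr_id mulVf ?gt_eqF.
by rewrite linearZ normrZ normfV normr_id ler_pdivrMl// mulrC.
Qed.

Lemma opnorm_ge0 (X Y : normedModType R) (L : X -> Y) : (0 <= opnorm L)%E.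
Proof.
apply: (@le_trans _ _ `|L 0|%:E); first by rewrite lee_fin.
by apply: ereal_sup_ubound; exists 0 => //=; rewrite normr0.
Qed.

Lemma opnorm_cvg0P (X Y : normedModType R) (I : Type) (F : set_system I)
    (L : I -> {linear X -> Y}) : Filter F ->
  opnorm (L i) @[i --> F] --> 0%E <->
  (forall e, 0 < e -> \forall i \near F, forall v, `|L i v| <= e * `|v|).
Proof.
move=> FF; split=> [L0 e e0|L0].
  have /fine_cvgP[Lfin /cvgr0Pnorm_le L0'] := L0.
  have /(_ _ e0) := L0'; move: Lfin; apply: filterS2 => i /= Li le.
  apply/opnorm_leP; first exact: ltW.
  by rewrite -(fineK Li) lee_fin (le_trans (ler_norm _)).
apply/fine_cvgP; split.
  have := L0 _ ltr01; apply: filterS => i /(opnorm_leP _ ler01).2 Li.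
  by rewrite ge0_fin_numE ?opnorm_ge0// (le_lt_trans Li) ?ltry.
apply/cvgr0Pnorm_le => e e0; have := L0 _ e0.
apply: filterS => i /(opnorm_leP _ (ltW e0)).2 Li /=.
rewrite ger0_norm ?fine_ge0 ?opnorm_ge0// -lee_fin fineK//.
by rewrite ge0_fin_numE ?opnorm_ge0// (le_lt_trans Li) ?ltry.
Qed.

End Norms.

Lemma bounded_linear_cont (R : realType) (X Y : normedModType R)
    (L : {linear X -> Y}) (k : R) :
  (forall v, `|L v| <= k * `|v|) -> continuous L.
Proof.
move=> Lk; apply/linear_bounded_continuous/bounded_funP => r.
exists (`|k| * r) => x xr; rewrite (le_trans (Lk x))//.
by rewrite (le_trans (ler_wpM2r _ (ler_norm k)))// ler_wpM2l.
Qed.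

Section Differential.
Context {R : realType} {X Y : normedModType R}.

Lemma differentiable_near (f : X -> Y) x : differentiable f x ->
  forall e, 0 < e -> \forall y \near x,
    `|f y - f x - 'd f x (y - x)| <= e * `|y - x|.
Proof.
move=> /diff_locally/eqaddoP df e e0.
have := df _ e0; rewrite /= !near_simpl => dfe.
rewrite (near_shift 0) /=; move: dfe; apply: filterS => h /=.
rewrite subr0 addrK /cst /=.
by rewrite -[X in `|X| <= _ -> _]/(f (h + x) - (f x + 'd f x h)) opprD addrA.
Qed.

(** ['d f x] is defined by choice; uniqueness identifies it with any continuous
    linear first-order approximation. *)
Lemma diff_of_near (f : X -> Y) x (A : {linear X -> Y}) : continuous A ->
  (forall e, 0 < e -> \forall y \near x,
    `|f y - f x - A (y - x)| <= e * `|y - x|) ->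
  differentiable f x /\ 'd f x = A :> (X -> Y).
Proof.
move=> Ac fA.
have fE : f \o shift x = cst (f x) + A +o_ 0 id.
  apply/eqaddoP => e e0; rewrite /= !near_simpl.
  have := fA e e0; rewrite (near_shift 0) /=; apply: filterS => h /=.
  rewrite subr0 addrK /cst /=.
  by rewrite -[X in _ -> `|X| <= _]/(f (h + x) - (f x + A h)) opprD addrA.
have dfA := diff_unique Ac fE.
by split=> //; apply/diff_locallyP; rewrite dfA.
Qed.

End Differential.

(** * Mean value inequality *)

Section MeanValue.
Context {R : realType}.

(** The hypothesis is a Lipschitz bound at each point separately.  The times
    at which the bound from [0] holds contain their supremum [s], since some
    such time lies within [eta] of [s]; and if [s < 1], a short step to the
    right of [s] stays among them. *)
Lemma segment_dist_le (Y : normedModType R) (phi : R -> Y) (K : R) :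
  (forall s, 0 <= s <= 1 -> exists2 eta, 0 < eta &
    forall t, 0 <= t <= 1 -> `|t - s| < eta ->
      `|phi t - phi s| <= K * `|t - s|) ->
  `|phi 1 - phi 0| <= K.
Proof.
move=> phiK.
pose S := [set t : R | 0 <= t <= 1 /\ `|phi t - phi 0| <= K * t].
have S0 : S 0 by split; rewrite ?lexx ?ler01// mulr0 subrr normr0.
have Sub : ubound S 1 by move=> t [/andP[]].
have supS : has_sup S by split; [exists 0|exists 1].
set s := sup S.
have s0 : 0 <= s by apply: ub_le_sup => //; exists 1.
have s1 : s <= 1 by apply: ge_sup => //; exists 0.
have s01 : 0 <= s <= 1 by rewrite s0.
have [eta eta0 phis] := phiK s s01.
have [t [t01 St] st] := sup_adherent eta0 supS.
have ts : t <= s by apply: ub_le_sup => //; exists 1.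
have Ss : `|phi s - phi 0| <= K * s.
  have : `|phi t - phi s| <= K * `|t - s|.
    by apply: phis => //; rewrite distrC ger0_norm ?subr_ge0// ltrBlDl -ltrBlDr.
  rewrite distrC [`|t - s|]distrC (ger0_norm (_ : 0 <= s - t)) ?subr_ge0// => pst.
  rewrite (le_trans (ler_distD (phi t) _ _))// (le_trans (lerD pst St))//.
  by rewrite -mulrDr subrK.
have [s_eq1|s_neq1] := eqVneq s 1; first by move: Ss; rewrite s_eq1 mulr1.
have slt1 : s < 1 by rewrite lt_neqAle s_neq1.
pose u := Num.min 1 (s + eta / 2).
have su : s < u by rewrite lt_min slt1 ltrDl divr_gt0.
have u01 : 0 <= u <= 1 by rewrite (le_trans s0 (ltW su)) ge_min lexx.
have ueta : u <= s + eta / 2 by rewrite ge_min lexx orbT.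
have : u <= s.
  apply: ub_le_sup; first by exists 1.
  split=> //; rewrite (le_trans (ler_distD (phi s) _ _))//.
  have : `|phi u - phi s| <= K * `|u - s|.
    apply: phis => //; rewrite ger0_norm ?subr_ge0 ?(ltW su)// ltrBlDl.
    by move: ueta eta0; lra.
  rewrite (ger0_norm (_ : 0 <= u - s)) ?subr_ge0 ?(ltW su)// => pus.
  by rewrite (le_trans (lerD pus Ss))// -mulrDr subrK.
by rewrite leNgt su.
Qed.

(** Along the segment, differentiability gives the pointwise Lipschitz bound of
    [segment_dist_le] with the constant [(M + e') * `|b - a|] for every
    positive [e']. *)
Lemma mean_value_le (X Y : normedModType R) (f : X -> Y) (a b : X) (M : R) :
  0 <= M ->
  (forall t, 0 <= t <= 1 -> differentiable f (a + t *: (b - a))) ->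
  (forall t v, 0 <= t <= 1 -> `|'d f (a + t *: (b - a)) v| <= M * `|v|) ->
  `|f b - f a| <= M * `|b - a|.
Proof.
move=> M0 df dfM; apply/ler_addgt0Pr => e e0.
set d := `|b - a|; have d0 : 0 <= d by exact: normr_ge0.
(* d may vanish, hence the denominator d + 1 *)
pose e' := e / (d + 1).
have d1 : 0 < d + 1 by rewrite ltr_wpDl.
have e'0 : 0 < e' by rewrite divr_gt0.
pose gamma t : X := a + t *: (b - a).
have gammaB t s : gamma t - gamma s = (t - s) *: (b - a).
  by rewrite /gamma opprD addrACA subrr add0r -scalerBl.
apply: (@le_trans _ _ ((M + e') * d)); last first.
  rewrite mulrDl lerD2l /e' -mulrA ger_pMr// mulrC ler_pdivrMr//; lra.
have -> : f b - f a = f (gamma 1) - f (gamma 0).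
  by rewrite /gamma scale1r scale0r addr0 subrKC.
apply: (@segment_dist_le _ (f \o gamma)) => s s01.
have := differentiable_near (df s s01) e'0.
move=> /nbhs_ballP[r /= r0 fr]; exists (r / (d + 1)); first by rewrite divr_gt0.
move=> t t01 ts; have /fr/= : ball (gamma s) r (gamma t).
  rewrite -ball_normE/= distrC gammaB normrZ -/d.
  rewrite (@le_lt_trans _ _ (`|t - s| * (d + 1)))//; last by rewrite -ltr_pdivlMr.
  by rewrite ler_wpM2l//; lra.
rewrite -!/(gamma _) => fts.
rewrite -(subrK ('d f (gamma s) (gamma t - gamma s)) (_ - _)).
rewrite (le_trans (ler_normD _ _))// (le_trans (lerD fts (dfM _ _ s01)))//.
rewrite gammaB normrZ -/d; lra.
Qed.

End MeanValue.

(** * Perturbations of the identity by a map of Lipschitz constant 1/2 *)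

Section Contraction.
Context {R : realType} {X : completeNormedModType R}.

(** A first step of length at most [r / 2] keeps the closed ball of radius [r]
    invariant, which is what the fixed point theorem needs. *)
Lemma half_contraction_fixpoint (G : X -> X) (p : X) (r : R) : 0 <= r ->
  `|G p - p| <= r / 2 ->
  (forall x y, `|x - p| <= r -> `|y - p| <= r -> `|G x - G y| <= `|x - y| / 2) ->
  exists2 x, `|x - p| <= r & G x = x.
Proof.
move=> r0 Gp GL; pose U := [set x : X | `|x - p| <= r].
have UE : U = closed_ball_ Num.norm p r.
  by apply/seteqP; split=> x /=; rewrite /U/closed_ball_/= distrC.
have Up : U p by rewrite /U/= subrr normr0.
have GU : set_fun U U G.
  move=> x Ux; rewrite /U/= (le_trans (ler_distD (G p) _ _))//.
  have := GL x p Ux Up; move: Ux Gp; rewrite /U/=; lra.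
pose g : {fun U >-> U} := HB.pack G (isFun.Build _ _ U U G GU).
have gctr : is_contraction g.
  exists (2^-1)%:nng; split=> /=; first lra.
  by move=> -[x y] [/= Ux Uy]; rewrite mulrC; exact: GL.
have [||x Ux xE] := banach_fixed_point gctr; last by exists x => //; rewrite {2}xE.
- by rewrite UE; exact: closed_closed_ball_.
- by exists p.
Qed.

(** Injectivity of [id + T], with a Lipschitz bound for its inverse. *)
Lemma half_perturbation_expand (T : X -> X) (x y : X) :
  `|T x - T y| <= `|x - y| / 2 -> `|x - y| <= 2 * `|(x + T x) - (y + T y)|.
Proof.
move=> Txy; have := ler_normB ((x + T x) - (y + T y)) (T x - T y).
have -> : x + T x - (y + T y) - (T x - T y) = x - y.
  by rewrite opprD addrACA addrK.
lra.
Qed.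

(** The equation [x + T x = w] is the fixed point equation of the contraction
    [x |-> w - T x]; uniqueness of its solution makes the inverse linear. *)
Lemma half_perturbation_inverse (T : {linear X -> X}) :
  (forall v, `|T v| <= `|v| / 2) ->
  exists2 B : {linear X -> X},
    forall w, B w + T (B w) = w & forall w, `|B w| <= 2 * `|w|.
Proof.
move=> T2.
have TB x y : `|T x - T y| <= `|x - y| / 2 by rewrite -linearB.
have expand v : `|v| <= 2 * `|v + T v|.
  by have := half_perturbation_expand (TB v 0); rewrite linear0 addr0 !subr0.
have inj x y : x + T x = y + T y -> x = y.
  move=> xy; apply/eqP; rewrite -subr_eq0 -normr_le0.
  by have := half_perturbation_expand (TB x y); rewrite xy subrr normr0 mulr0.
have /choice[B BE] w : exists x, x + T x = w.
  have [||x y _ _|x _ xE] := @half_contraction_fixpoint (fun x => w - T x) 0 (2 * `|w|).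
  - by rewrite mulr_ge0.
  - by rewrite linear0 !subr0 mulrC mulrA mulVf ?mul1r.
  - by rewrite opprB addrC addrA subrK distrC.
  - by exists x; rewrite -{1}xE subrK.
have Blin : linear B.
  by move=> a u v; apply: inj; rewrite BE linearP addrACA -scalerDr !BE.
pose BL : {linear X -> X} := HB.pack B (GRing.isLinear.Build _ _ _ _ B Blin).
by exists BL => // w; rewrite -{2}(BE w); exact: expand.
Qed.

End Contraction.

(** * The Newton-Picard map *)

Section NewtonPicard.
Context {R : realType} {X Y : completeNormedModType R}.
Variables (f : X -> Y) (D : {linear X -> Y}) (Q : {linear Y -> X}).
Variables (x0 : X) (delta c : R).
Hypothesis delta_gt0 : 0 < delta.
Hypothesis c_gt0 : 0 < c.
Hypothesis Q_rinv : forall y, D (Q y) = y.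
Hypothesis Q_le : forall y, `|Q y| <= c * `|y|.
Hypothesis defect_le : forall x y, `|x - x0| < delta -> `|y - x0| < delta ->
  `|(f x - D x) - (f y - D y)| <= 1 / (2 * c) * `|x - y|.

(** The corrected map [Phi] is [x |-> x + T x]. *)
Let T x := Q (f x - D x).
Let N := newton_picard f x0 Q delta.
Let dom := newton_picard_dom f x0 delta c.

Let Qhalf y r : `|y| <= 1 / (2 * c) * r -> `|Q y| <= r / 2.
Proof.
move=> yr; rewrite (le_trans (Q_le y))// -ler_pdivlMl// (le_trans yr)//.
by suff -> : 1 / (2 * c) * r = c^-1 * (r / 2) by []; field; exact: lt0r_neq0.
Qed.

Lemma defect_half x y : `|x - x0| < delta -> `|y - x0| < delta ->
  `|T x - T y| <= `|x - y| / 2.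
Proof. by move=> xd yd; rewrite /T -linearB Qhalf// defect_le. Qed.

Let subr_swap (a b a' b' : X) : a - b = a' - b' <-> b - b' = a - a'.
Proof.
suff E : (a - b == a' - b') = (b - b' == a - a')
  by split=> /eqP; rewrite (E, =^~ E) => /eqP.
by rewrite [RHS]eq_sym !subr_eq [a' - b' + b]addrC addrCA [a' + _]addrC.
Qed.

(** From left to right, apply [D] and use [D \o Q = id].  From right to left,
    [Q \o D] is the identity on the range of [Q]. *)
Lemma root_defectP x x1 :
  x + T x = x1 - Q (D x1) <-> f x = 0 /\ range Q (x - x1).
Proof.
split=> [xE|[fx [y _ yE]]]; last first.
  have : Q (D (x - x1)) = x - x1 by rewrite -yE Q_rinv.
  by rewrite /T fx sub0r linearN 2!linearB => /((subr_swap _ _ _ _).2).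
have fx : f x = 0.
  have := congr1 D xE; rewrite /T [LHS]linearD [RHS]linearB !Q_rinv subrr.
  by rewrite addrC subrK.
split=> //; exists (D (x - x1)) => //.
by rewrite 2!linearB; apply: (subr_swap _ _ _ _).1; rewrite -xE /T fx sub0r linearN.
Qed.


(** The solution is a fixed point of [G x := x1 - Q (D x1) - T x], found in the
    closed ball of radius [delta / 2] around [x1]; this ball lies inside the open
    ball of radius [delta] around [x0] because [1/2 + 1/8 < 1]. *)
Lemma solution_exists x1 : dom x1 -> exists x,
  [/\ f x = 0, range Q (x - x1) & `|x - x0| < delta].
Proof.
have d0 := delta_gt0; move=> [x1d fx1].
have x1x0 : `|x1 - x0| < delta / 8 by move: x1d; rewrite -ball_normE/= distrC.
have inball x : `|x - x1| <= delta / 2 -> `|x - x0| < delta.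
  move=> xx1; rewrite (le_lt_trans (ler_distD x1 _ _))//; lra.
have x1x1 : `|x1 - x1| <= delta / 2 by rewrite subrr normr0; lra.
pose G x := x1 - Q (D x1) - T x.
have [|||x xx1 Gx] := @half_contraction_fixpoint _ _ G x1 (delta / 2).
- lra.
(* the first step is at most c * (delta / (4 * c)) = delta / 4 *)
- have -> : G x1 - x1 = - Q (f x1).
    by rewrite /G /T linearB opprB addrA subrK addrAC subrr add0r.
  rewrite normrN (le_trans (Q_le _))//.
  rewrite -ler_pdivlMl// (le_trans (ltW fx1))//.
  by suff -> : delta / (4 * c) = c^-1 * (delta / 2 / 2) by []; field; exact: lt0r_neq0.
- move=> x y /inball xd /inball yd.
  by rewrite /G opprB addrC addrA subrK distrC; exact: defect_half.
have [fx Qx] : f x = 0 /\ range Q (x - x1).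
  by apply/root_defectP; rewrite -{1}Gx subrK.
by exists x; split=> //; exact: inball.
Qed.

Lemma newton_picardP x1 : dom x1 ->
  `|N x1 - x0| < delta /\ N x1 + T (N x1) = x1 - Q (D x1).
Proof.
move=> /solution_exists/(@xgetPex _ 0)[fN QN Nd].
by split=> //; apply/root_defectP.
Qed.

Lemma newton_picard_lipschitz x y k : (forall v, `|v - Q (D v)| <= k * `|v|) ->
  dom x -> dom y -> `|N x - N y| <= 2 * k * `|x - y|.
Proof.
move=> Dk /newton_picardP[xd xE] /newton_picardP[yd yE].
rewrite (le_trans (half_perturbation_expand (defect_half xd yd)))//.
rewrite xE yE -mulrA ler_pM2l//; have := Dk (x - y).
by rewrite 2!linearB !opprD addrACA.
Qed.


Lemma newton_picard_dom_nbhs x1 : dom x1 ->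
  (forall x, `|x - x0| < delta -> {for x, continuous f}) ->
  \forall y \near x1, dom y.
Proof.
have d0 := delta_gt0; move=> [x1d fx1] fc.
have fc1 : {for x1, continuous f}.
  by apply: fc; move: x1d; rewrite -ball_normE/= distrC; lra.
near=> y; split; near: y.
- by apply: open_nbhs_nbhs; split=> //; exact: ball_open.
- exact: (cvgr_lt _ (cvg_norm fc1)).
Unshelve. all: by end_near. Qed.

Lemma newton_picard_cvg x1 k : 0 < k ->
  (forall v, `|v - Q (D v)| <= k * `|v|) ->
  dom x1 -> (\forall y \near x1, dom y) -> N y @[y --> x1] --> N x1.
Proof.
move=> k0 Dk x1d neard; apply/cvgrPdist_le => e e0; near=> y.
have yd : dom y by near: y.
rewrite (le_trans (newton_picard_lipschitz Dk x1d yd))//.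
rewrite -ler_pdivlMl ?mulr_gt0//; near: y.
apply: (@cvgr_dist_le _ _ _ _ _ id); first exact: cvg_id.
by rewrite mulr_gt0// invr_gt0 mulr_gt0.
Unshelve. all: by end_near. Qed.

(** The differential is [L := B \o P], with [B] the inverse of
    [id + Q \o ('d f (N x1) - D)].  Let [w] be the error
    [N y - N x1 - L (y - x1)].  Applying the operator to [w] cancels all terms
    except [- Q r], where [r] is the first-order remainder of [f] at [N x1]
    evaluated at [N y]; as [N] is Lipschitz, [r] is small compared with
    [y - x1]. *)
Lemma newton_picard_diff x1 k : 0 < k ->
  (forall v, `|v - Q (D v)| <= k * `|v|) ->
  dom x1 -> (\forall y \near x1, dom y) ->
  differentiable f (N x1) ->
  (forall v, `|'d f (N x1) v - D v| <= 1 / (2 * c) * `|v|) ->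
  differentiable N x1 /\
  (forall v, 'd N x1 v + Q ('d f (N x1) ('d N x1 v) - D ('d N x1 v))
             = v - Q (D v)).
Proof.
move=> k0 Dk x1d neard df dfD.
pose P : {linear X -> X} := idfun \- (Q \o D).
pose A : {linear X -> X} := Q \o ('d f (N x1) \- D).
have A2 v : `|A v| <= `|v| / 2 by exact: Qhalf (dfD v).
have [B BE B2] := half_perturbation_inverse A2.
pose L : {linear X -> X} := B \o P.
have LE v : L v + A (L v) = P v by exact: BE.
(* the norms of B and of P are at most 2 and k *)
have Lk v : `|L v| <= 2 * k * `|v|.
  by rewrite (le_trans (B2 _))// -mulrA ler_pM2l//; exact: Dk.
have Lc : continuous L by exact: bounded_linear_cont Lk.
have [|dN NL] := @diff_of_near _ _ _ N x1 L Lc; last first.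
  by split=> // v; rewrite NL; exact: LE.
move=> e e0.
(* the error is at most 2 * c * e' * (2 * k) times the distance of y and x1 *)
pose e' := e / (4 * c * k).
have e'0 : 0 < e' by rewrite divr_gt0 ?mulr_gt0.
have Ncvg := newton_picard_cvg k0 Dk x1d neard.
near=> y.
have yd : dom y by near: y.
have rle : `|f (N y) - f (N x1) - 'd f (N x1) (N y - N x1)| <= e' * `|N y - N x1|.
  by near: y; exact: Ncvg _ (differentiable_near df e'0).
set r := f (N y) - _ - _ in rle.
set w := N y - N x1 - L (y - x1).
have wE : w + A w = - Q r.
  have PE : P (y - x1) = (N y - N x1) + (T (N y) - T (N x1)).
    rewrite linearB addrACA -opprD.
    by rewrite (newton_picardP yd).2 (newton_picardP x1d).2.
  rewrite /w [A _]linearB addrACA -opprD LE PE opprD addrACA subrr add0r.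
  rewrite -[A _]/(Q ('d f (N x1) (N y - N x1) - D (N y - N x1))).
  rewrite /T -!(raddfB Q) -(raddfN Q); congr (Q _).
  have -> : f (N y) - D (N y) - (f (N x1) - D (N x1))
            = f (N y) - f (N x1) - D (N y - N x1).
    by rewrite (raddfB D) !opprD addrACA.
  by rewrite opprB addrA subrK /r !opprB.
have : `|w| <= 2 * `|w + A w|.
  have := @half_perturbation_expand _ _ A w 0.
  by rewrite linear0 addr0 !subr0; apply; exact: A2.
rewrite wE normrN => /le_trans; apply.
have NL := newton_picard_lipschitz Dk yd x1d.
rewrite (@le_trans _ _ (2 * (c * (e' * (2 * k * `|y - x1|)))))//.
  rewrite ler_pM2l// (le_trans (Q_le _))// ler_pM2l// (le_trans rle)//.
  by rewrite ler_pM2l.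
suff -> : 2 * (c * (e' * (2 * k * `|y - x1|))) = e * `|y - x1| by [].
by rewrite /e'; field; rewrite !lt0r_neq0.
Unshelve. all: by end_near. Qed.


(** Inserting [u] into the equation of [u'] leaves the residual
    [Q (E u - E' u)], and both operators expand by at least [1/2]. *)
Lemma implicit_diff_close (E E' : {linear X -> Y}) (u u' p : X) (e : R) :
  0 <= e ->
  (forall v, `|E v - D v| <= 1 / (2 * c) * `|v|) ->
  (forall v, `|E' v - D v| <= 1 / (2 * c) * `|v|) ->
  u + Q (E u - D u) = p -> u' + Q (E' u' - D u') = p ->
  `|E' u - E u| <= e * `|u| -> `|u' - u| <= 4 * c * e * `|p|.
Proof.
move=> e0 ED ED' uE u'E EE'.
have half (F : {linear X -> Y}) : (forall v, `|F v - D v| <= 1 / (2 * c) * `|v|) ->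
    forall a b, `|a - b| <= 2 * `|(a + Q (F a - D a)) - (b + Q (F b - D b))|.
  move=> FD a b; apply: (@half_perturbation_expand _ _ (fun v => Q (F v - D v))).
  rewrite -(raddfB Q); apply: Qhalf.
  by rewrite opprD addrACA -opprD -(raddfB F) -(raddfB D); exact: FD.
have up : `|u| <= 2 * `|p|.
  have := half E ED u 0.
  by rewrite uE (raddf0 E) (raddf0 D) subrr (raddf0 Q) addr0 !subr0.
rewrite (le_trans (half E' ED' u' u))// u'E -[X in X - _]uE opprD addrACA subrr add0r.
rewrite -(raddfB Q) opprB addrA subrK -normrN -(raddfN Q) opprB.
rewrite [leRHS](_ : _ = 2 * (c * (e * (2 * `|p|)))); last by ring.
rewrite ler_pM2l// (le_trans (Q_le _))// ler_pM2l// (le_trans EE')//.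
by rewrite ler_wpM2l.
Qed.

End NewtonPicard.

(** * Continuous differentiability *)

Lemma ball_segment (R : realType) (X : normedModType R) (x0 x y : X) (r t : R) :
  `|x - x0| < r -> `|y - x0| < r -> 0 <= t <= 1 ->
  `|x + t *: (y - x) - x0| < r.
Proof.
move=> xr yr /andP[t0 t1].
have -> : x + t *: (y - x) - x0 = (1 - t) *: (x - x0) + t *: (y - x0).
  rewrite scalerBl scale1r -[RHS]addrA [- (t *: _) + _]addrC -scalerBr opprB.
  rewrite [y - x0 + _]addrA subrK.
  by rewrite addrAC.
rewrite (le_lt_trans (ler_normD _ _))// !normrZ ger0_norm ?subr_ge0// ger0_norm//.
have [->|tN0] := eqVneq t 0; first by rewrite subr0 mul1r mul0r addr0.
have : 0 < t * (r - `|y - x0|) by rewrite mulr_gt0 ?subr_gt0// lt_neqAle eq_sym tN0.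
have : 0 <= (1 - t) * (r - `|x - x0|) by rewrite mulr_ge0 ?subr_ge0// ltW.
lra.
Qed.

Theorem theoremB4 (R : realType) (X Y : completeNormedModType R)
  (U : set X) (f : X -> Y) (x0 : X) (Q : {linear Y -> X}) (delta c : R)
  (U_open : open U)
  (f_C1 : continuously_differentiable_on U f)
  (Ux0 : U x0)
  (D_surj : range ('d f x0) = setT)
  (Q_bounded : continuous Q)
  (Q_rinv : forall y : Y, 'd f x0 (Q y) = y)
  (delta_gt0 : 0 < delta)
  (c_gt0 : 0 < c)
  (Q_le : (opnorm Q <= c%:E)%E)
  (ball_sub : ball x0 delta `<=` U)
  (df_close : forall x : X, `|x - x0| < delta ->
     (opnorm ('d f x \- 'd f x0)%R <= (1 / (2 * c))%:E)%E) :
  continuously_differentiable_on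
    (newton_picard_dom f x0 delta c)
    (newton_picard f x0 Q delta).
Proof.
have [f_diff f_cont] := f_C1.
have inU x : `|x - x0| < delta -> U x.
  by move=> xd; apply: ball_sub; rewrite -ball_normE/= distrC.
have fD x : `|x - x0| < delta -> differentiable f x by move=> /inU /f_diff.
have Q_le' := (opnorm_leP Q (ltW c_gt0)).1 Q_le.
have c2 : 0 <= 1 / (2 * c) by rewrite divr_ge0// mulr_ge0// ltW.
have df_close' x v : `|x - x0| < delta ->
    `|'d f x v - 'd f x0 v| <= 1 / (2 * c) * `|v|.
  by move=> xd; exact: (opnorm_leP ('d f x \- 'd f x0) c2).1 (df_close _ xd) v.
have D_cont : continuous ('d f x0) by apply: diff_continuous; exact: f_diff.
have defect x y : `|x - x0| < delta -> `|y - x0| < delta ->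
    `|(f x - 'd f x0 x) - (f y - 'd f x0 y)| <= 1 / (2 * c) * `|x - y|.
  move=> xd yd.
  pose D : X -> Y := 'd f x0.
  have dg p : `|p - x0| < delta -> is_diff p (f - D) (('d f p : X -> Y) - D).
    move=> pd; apply: is_diffB; first by apply/differentiableP/fD.
    by apply: DiffDef; [exact: linear_differentiable|exact: diff_lin].
  apply: (@mean_value_le _ _ _ (f - D) y x) => // t.
  - by move=> t01; have [] := dg _ (ball_segment yd xd t01).
  - move=> v t01; have pd := ball_segment yd xd t01.
    by have [_ ->] := dg _ pd; exact: df_close'.
(* a bound for the norm of the projection id - Q \o D *)
have [kD kD0 Dk] := linear_lipschitz D_cont.
pose k := 1 + c * kD; have k0 : 0 < k by rewrite addr_gt0// mulr_gt0.
have Pk v : `|v - Q ('d f x0 v)| <= k * `|v|.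
  rewrite (le_trans (ler_normB _ _))// mulrDl mul1r lerD2l (le_trans (Q_le' _))//.
  by rewrite -mulrA ler_pM2l.
set N := newton_picard f x0 Q delta; set dom := newton_picard_dom f x0 delta c.
have near_dom x1 : dom x1 -> \forall y \near x1, dom y.
  move=> x1d; apply: newton_picard_dom_nbhs => // x xd.
  exact/differentiable_continuous/fD.
have NP x1 : dom x1 -> `|N x1 - x0| < delta /\
    N x1 + Q (f (N x1) - 'd f x0 (N x1)) = x1 - Q ('d f x0 x1).
  exact: newton_picardP.
have dN x1 : dom x1 -> differentiable N x1 /\
    (forall v, 'd N x1 v + Q ('d f (N x1) ('d N x1 v) - 'd f x0 ('d N x1 v))
             = v - Q ('d f x0 v)).
  move=> x1d; have [Nd _] := NP _ x1d.
  apply: (newton_picard_diff _ _ _ _ defect k0) => //; first exact: near_dom.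
  - exact: fD.
  - by move=> v; exact: df_close'.
split=> [x1 /dN[]//|x1 x1d].
apply/(@opnorm_cvg0P _ _ _ _ _ (fun y => 'd N y \- 'd N x1)) => e e0.
pose e' := e / (4 * c * k).
have e'0 : 0 < e' by rewrite divr_gt0 ?mulr_gt0.
have Nx1d := (NP _ x1d).1.
have Ncvg : N y @[y --> x1] --> N x1.
  by apply: (newton_picard_cvg _ _ _ _ defect k0) => //; exact: near_dom.
have := f_cont _ (inU _ Nx1d).
move=> /(@opnorm_cvg0P _ _ _ _ _ (fun y => 'd f y \- 'd f (N x1))) /(_ e' e'0).
rewrite near_withinE => /Ncvg; rewrite near_simpl => df_near.
rewrite near_withinE; near=> y => yd v.
have Nyd := (NP _ yd).1.
have dfNy : forall v, `|'d f (N y) v - 'd f (N x1) v| <= e' * `|v|.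
  by move: (inU _ Nyd); near: y.
have := implicit_diff_close (p := v - Q ('d f x0 v)) c_gt0 Q_le' (ltW e'0)
  (fun v => df_close' _ v Nx1d) (fun v => df_close' _ v Nyd)
  ((dN _ x1d).2 v) ((dN _ yd).2 v) (dfNy _).
move=> /le_trans; apply.
rewrite [leRHS](_ : _ = 4 * c * e' * (k * `|v|)); last first.
  by rewrite /e'; field; rewrite !lt0r_neq0.
apply: ler_wpM2l; last exact: Pk.
by apply: mulr_ge0; [apply: mulr_ge0 => //; exact: ltW|exact: ltW].
Unshelve. all: by end_near. Qed.
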